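(* Let $f:\mathbb{R}^d\to\mathbb{R}$ be differentiable, convex and $L$-smooth, suppose that there is $\theta^*\in\mathbb{R}^d$ with $f(\theta^* )=\inf_{\theta\in\mathbb{R}^d}f(\theta)$, and that there is $c\in\mathbb{R}^d$ such that the sublevel set $\{x\in\mathbb{R}^d: f(x)\le f(c)\}$ is bounded. Let $\mathcal{D}$ be a probability distribution on $\mathbb{R}^d$ such that (i) $\mathbb{E}_{s\sim\mathcal{D}}[\|s\|_2^2]<\infty$; (ii) there are a norm $\|\cdot\|_{\mathcal{D}}$ on $\mathbb{R}^d$ and a constant $\mu_{\mathcal{D}}>0$ with $\mathbb{E}_{s\sim\mathcal{D}}|\langle v,s\rangle|\ge\mu_{\mathcal{D}}\|v\|_{\mathcal{D}}$ for all $v\in\mathbb{R}^d$; (iii) $\mathbb{P}_{s\sim\mathcal{D}}(\|s\|_2\le1)=1$. Let $\theta^1\in\mathbb{R}^d$ be the initial point, and let $$R=\sup_{\theta\in\mathbb{R}^d,\ f(\theta)\le f(\theta^1)}\|\theta-\theta^*\|_{\mathcal{D}}^*,$$ which is finite, and assume $R>0$. Let $\{\theta^t\}_{t\ge1}$ be generated from $\theta^1$ by the Stochastic Three Points (STP) algorithm with step sizes $\alpha_t=\frac{\alpha}{t}$, where $\alpha>\frac{R}{\mu_{\mathcal{D}}}$. Then for all $T\ge1$, $$\mathbb{E}[f(\theta^T)]-f(\theta^* )\le\frac{a}{T},\qquad a=\max\left(\frac{3\alpha\mu_{\mathcal{D}}}{R}\bigl(f(\theta^1)-f(\theta^* )\bigr),\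 \frac{L\alpha^2}{2\left(\frac{\alpha\mu_{\mathcal{D}}}{R}-1\right)}\right).$$ In particular, if $\mu_{\mathcal{D}}$ is proportional to $\frac{1}{\sqrt d}$, i.e. $\mu_{\mathcal{D}}=\frac{K}{\sqrt d}$ for a constant $K>0$, and $\alpha=\frac{2R}{\mu_{\mathcal{D}}}$, then $\mathbb{E}[f(\theta^T)]-f(\theta^* )=O\left(\frac dT\right)$, i.e. it is at most $C\frac dT$ for all $T\ge1$ with $C$ depending only on $K$, $L$, $R$ and $f(\theta^1)-f(\theta^* )$.
   Context: $L$-smooth means $\|\nabla f(x)-\nabla f(y)\|_2\le L\|x-y\|_2$ for all $x,y\in\mathbb{R}^d$. The dual norm is $\|\theta\|_{\mathcal{D}}^*=\sup_{v\in\mathbb{R}^d\setminus\{0\}}\frac{\langle v,\theta\rangle}{\|v\|_{\mathcal{D}}}$. STP algorithm: given a deterministic initial point $\theta^1\in\mathbb{R}^d$, step sizes $\alpha_t>0$ and the distribution $\mathcal{D}$, for $t=1,2,\ldots$ draw a random vector $s_t\sim\mathcal{D}$ (the $s_t$ being independent) and set $\theta^{t+1}\in\arg\min_{\theta\in\{\theta^t,\ \theta^t+\alpha_ts_t,\ \theta^t-\alpha_ts_t\}}f(\theta)$, with ties broken by a fixed measurable rule depending only on $(t,\theta^t,s_t)$. *)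

(* Defs.v *)
From HB Require Import structures.
From mathcomp Require Import all_boot all_order all_algebra finmap.
From mathcomp Require Import all_classical all_reals all_analysis.
Import Order.TTheory GRing.Theory Num.Theory.
Import numFieldNormedType.Exports.

Set Implicit Arguments.
Unset Strict Implicit.
Unset Printing Implicit Defensive.

Local Open Scope classical_set_scope.
Local Open Scope ring_scope.

(* R^d is 'rV[R]_d, with its Borel sigma-algebra. *)
HB.instance Definition _ (R : realType) (m n : nat) :=
  @isMeasurable.Build (sigma_display (@open 'M[R]_(m, n))) 'M[R]_(m, n)
    <<s @open 'M[R]_(m, n) >> (@sigma_algebra0 _ setT _) (@sigma_algebraC _ _)
    (@sigma_algebra_bigcup _ setT _).

Section euclidean.
Context {R : realType} {d : nat}.
Implicit Types (u v x : 'rV[R]_d) (f N : 'rV[R]_d -> R).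

Definition dot u v : R := \sum_(i < d) u 0 i * v 0 i.

(* The library norm `|v| on 'rV[R]_d is the sup norm; this is the 2-norm. *)
Definition norm2 v : R := Num.sqrt (\sum_(i < d) v 0 i ^+ 2).

Definition grad f x : 'rV[R]_d := \row_(i < d) 'D_(delta_mx 0 i) f x.

Definition smooth (L : R) f : Prop :=
  forall x y, norm2 (grad f x - grad f y) <= L * norm2 (x - y).

Record is_norm N : Prop := IsNorm {
  norm_ge0 : forall v, 0 <= N v ;
  norm_eq0 : forall v, N v = 0 -> v = 0 ;
  norm_scale : forall (a : R) v, N (a *: v) = `|a| * N v ;
  norm_triangle : forall u v, N (u + v) <= N u + N v }.

(* Suprema are taken in \bar R, so that finiteness is a statement and not a
   default value of sup; they are -oo when d = 0. *)
Definition dual_norm N x : \bar R :=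
  ereal_sup [set (dot v x / N v)%:E | v in [set v | v != 0]].

Definition sublevel_radius f (theta_star : 'rV[R]_d) N (theta1 : 'rV[R]_d) : \bar R :=
  ereal_sup [set dual_norm N (theta - theta_star) |
             theta in [set theta | f theta <= f theta1]].

Definition argmin_on f (A : set 'rV[R]_d) : set 'rV[R]_d :=
  [set y | A y /\ forall z, A z -> f y <= f z].

End euclidean.

Definition mutually_independent d d' (T : measurableType d)
    (T' : measurableType d') (R : realType) (P : probability T R)
    (K : choiceType) (I : set K) (X : K -> {RV P >-> T'}) : Prop :=
  forall (J : {fset K}) (A : K -> set T'),
    [set` J] `<=` I -> (forall i, i \in J -> measurable (A i)) ->
    P (\bigcap_(i in [set` J]) (X i @^-1` A i)) =
    (\prod_(i <- J) P (X i @^-1` A i))%E.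

Section objects.
Context {R : realType} {d : nat}.
Implicit Types (f : 'rV[R]_d -> R).

Record objective f (L : R) (theta_star : 'rV[R]_d) : Prop := Objective {
  objective_differentiable : forall x, differentiable f x ;
  objective_convex :
    convex_function (setT : set (convex_lmodType 'rV[R]_d)) f ;
  objective_smooth : smooth L f ;
  objective_min :
    (f theta_star)%:E = ereal_inf [set (f theta)%:E | theta in setT] ;
  objective_bounded : exists c, bounded_set [set x | f x <= f c] }.

Record search_distribution (D : probability 'rV[R]_d R)
    (N : 'rV[R]_d -> R) (mu : R) : Prop := SearchDistribution {
  search_moment : ('E_D[fun s => (norm2 s ^+ 2)%R] < +oo)%E ;
  search_norm : is_norm N ;
  search_mu_gt0 : 0 < mu ;
  search_lower : forall v, ((mu * N v)%:E <= 'E_D[fun s => `|dot v s|%R])%E ;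
  search_unit : D [set s | norm2 s <= 1] = 1%E }.

(* The update is theta^{t+1} = step t theta^t s_t: [step] incorporates the
   measurable tie-breaking rule. *)
Definition stp_step f (alpha : nat -> R)
    (step : nat -> 'rV[R]_d -> 'rV[R]_d -> 'rV[R]_d) : Prop :=
  forall t, (0 < t)%N ->
    measurable_fun [set: 'rV[R]_d * 'rV[R]_d] (fun p => step t p.1 p.2) /\
    forall x s, argmin_on f
      [set x; x + alpha t *: s; x - alpha t *: s] (step t x s).

(* Iterates and directions are indexed from 1; [s 0] and [theta 0] are
   unconstrained and unused. *)
Record stp f (alpha : nat -> R) (D : probability 'rV[R]_d R)
    (theta1 : 'rV[R]_d) dO (Omega : measurableType dO)
    (P : probability Omega R) (s : nat -> {RV P >-> 'rV[R]_d})
    (theta : nat -> Omega -> 'rV[R]_d) : Prop := STP {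
  stp_alpha_gt0 : forall t, (0 < t)%N -> 0 < alpha t ;
  stp_law : forall t, (0 < t)%N ->
    forall A, measurable A -> distribution P (s t) A = D A ;
  stp_indep : mutually_independent [set t | (0 < t)%N] s ;
  stp_init : forall w, theta 1%N w = theta1 ;
  stp_iter : exists2 step, stp_step f alpha step &
    forall t, (0 < t)%N -> forall w, theta t.+1 w = step t (theta t w) (s t w) }.

End objects.

(* Main.v *)
(* With g = f - f(theta_star), the descent lemma applied to whichever of
   +s_t, -s_t is a descent direction gives, when |s_t|_2 <= 1,
     g(theta^{t+1}) <= g(theta^t) - alpha_t |<grad f(theta^t), s_t>| + L alpha_t^2 / 2.
   Since theta^t is independent of s_t, the slope term has expectation at least
   mu E[N(grad f(theta^t))], and convexity together with the duality between N
   and its dual norm bounds r N(grad f(theta^t)) below by g(theta^t).  Hence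
   e_t = E[g(theta^t)] satisfies, with b = alpha mu / r > 1,
     e_{t+1} <= (1 - b/t) e_t + L alpha^2 / (2 t^2),
   which yields e_t <= a / t by induction.  Finiteness of the radius follows from
   convexity (one bounded sublevel set makes all of them bounded) and the
   equivalence of norms on R^d. *)
Require Import Defs.
From HB Require Import structures.
From mathcomp Require Import all_boot all_order all_algebra finmap ring lra.
From mathcomp Require Import all_classical all_reals all_analysis.
From mathcomp Require Import measurable_realfun.
Import Order.TTheory GRing.Theory Num.Theory.
Import numFieldNormedType.Exports.

Set Implicit Arguments.
Unset Strict Implicit.
Unset Printing Implicit Defensive.

Local Open Scope classical_set_scope.
Local Open Scope ring_scope.

(** * Euclidean inequalities, the descent lemma and first-order convexity *)

Section euclidean_lemmas.
Context {R : realType} {d : nat}.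
Implicit Types (u v w x y : 'rV[R]_d) (a : R) (f : 'rV[R]_d -> R).

Lemma dotZr a u v : dot u (a *: v) = a * dot u v.
Proof. by rewrite /dot big_distrr/=; apply: eq_bigr => i _; rewrite mxE; ring. Qed.

Lemma dotNr u v : dot u (- v) = - dot u v.
Proof. by rewrite -scaleN1r dotZr mulN1r. Qed.

Lemma dotBl u v w : dot (u - v) w = dot u w - dot v w.
Proof. by rewrite /dot -sumrB; apply: eq_bigr => i _; rewrite !mxE mulrBl. Qed.

Lemma norm2_ge0 v : 0 <= norm2 v. Proof. exact: sqrtr_ge0. Qed.

Lemma norm2Z a v : norm2 (a *: v) = `|a| * norm2 v.
Proof.
rewrite /norm2 -sqrtr_sqr -sqrtrM ?sqr_ge0// big_distrr/=; congr Num.sqrt.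
by apply: eq_bigr => i _; rewrite mxE exprMn.
Qed.

(** With [A] and [B] the squared norms of [u] and [v], the squared norm of [B u - <u,v> v] equals
    [B (A B - <u,v>^2)] and is nonnegative. Dividing by [B] settles the case [B > 0]; if [B = 0]
    then [v = 0]. *)
Lemma cauchy_schwarz u v : dot u v <= norm2 u * norm2 v.
Proof.
set A := \sum_(i < d) u 0 i ^+ 2; set B := \sum_(i < d) v 0 i ^+ 2.
have A0 : 0 <= A by apply: sumr_ge0 => i _; exact: sqr_ge0.
have B0 : 0 <= B by apply: sumr_ge0 => i _; exact: sqr_ge0.
rewrite /norm2 -sqrtrM// (le_trans (ler_norm _))// -sqrtr_sqr ler_wsqrtr//.
have : 0 <= \sum_(i < d) (B * u 0 i - dot u v * v 0 i) ^+ 2.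
  by apply: sumr_ge0 => i _; exact: sqr_ge0.
have -> : \sum_(i < d) (B * u 0 i - dot u v * v 0 i) ^+ 2 =
    B * (A * B - dot u v ^+ 2).
  transitivity (\sum_(i < d) (B ^+ 2 * u 0 i ^+ 2 -
      2 * B * dot u v * (u 0 i * v 0 i) + dot u v ^+ 2 * v 0 i ^+ 2)).
    by apply: eq_bigr => i _; ring.
  by rewrite big_split/= sumrB -!mulr_sumr -/A -/B -/(dot u v); ring.
have [B_gt0|B_le0 _] := ltP 0 B; first by rewrite pmulr_rge0// subr_ge0.
have B_eq0 : B = 0 by apply/le_anti; rewrite B_le0 B0.
have v0 i : v 0 i = 0.
  apply/eqP; rewrite -sqrf_eq0; apply/eqP.
  by apply: (psumr_eq0P _ B_eq0) => // j _; exact: sqr_ge0.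
by rewrite /dot big1 ?expr0n ?mulr_ge0// => i _; rewrite v0 mulr0.
Qed.

Lemma derive_dot_grad f x v : differentiable f x -> 'D_v f x = dot (grad f x) v.
Proof.
move=> df; rewrite deriveE// [in LHS](row_sum_delta v) linear_sum.
by apply: eq_bigr => i _; rewrite linearZ /= mxE deriveE// mulrC.
Qed.

Lemma is_derive_line f x v (t : R) : (forall y, differentiable f y) ->
  is_derive t 1 (fun s : R => f (x + s *: v)) (dot (grad f (x + t *: v)) v).
Proof.
(* The difference quotient of the restriction to the line, at [t] in direction 1, is that of [f] at
   [x + t v] in direction [v]. *)
move=> df; have dE : (fun h : R => h^-1 *:
    (((fun s => f (x + s *: v)) \o shift t) (h *: 1) - f (x + t *: v))) =
    (fun h : R => h^-1 *: ((f \o shift (x + t *: v)) (h *: v) - f (x + t *: v))).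
  apply/funext => h /=; congr (_ *: (f _ - _)).
  by rewrite [h *: 1]mulr1 scalerDl addrCA addrA.
split; first by rewrite /derivable dE; exact: diff_derivable.
by rewrite -derive_dot_grad// /derive dE.
Qed.

(** The mean value theorem replaces the usual integral. Subtract from [f (x + s h)] the quadratic
    [q s], whose slope is [<grad f x, h> + L s |h|^2]. By Cauchy-Schwarz and smoothness the
    difference has nonpositive slope on (0, 1), so it does not increase from 0 to 1. *)
Lemma descent_lemma (L : R) f x h : (forall y, differentiable f y) -> smooth L f ->
  f (x + h) <= f x + dot (grad f x) h + L / 2 * norm2 h ^+ 2.
Proof.
move=> df Lf.
pose q (s : R) : R := dot (grad f x) h * s + L / 2 * norm2 h ^+ 2 * s ^+ 2.
have dq (t : R) : is_derive t 1 q (dot (grad f x) h + L * norm2 h ^+ 2 * t).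
  rewrite /q; apply: is_derive_eq; by rewrite /GRing.scale/=; field.
have dphi (t : R) : is_derive t 1 (fun s : R => f (x + s *: h) - q s)
    (dot (grad f (x + t *: h)) h - (dot (grad f x) h + L * norm2 h ^+ 2 * t)).
  by have dl := is_derive_line x h t df; exact: is_deriveB.
have cphi : {within `[0, 1], continuous (fun s : R => f (x + s *: h) - q s)}.
  apply: continuous_subspaceT. move=> s; apply: differentiable_continuous.
  by apply/derivable1_diffP; have [] := dphi s.
have [t] := MVT ltr01 (fun t _ => dphi t) cphi.
rewrite in_itv/= => /andP[t0 t1]; rewrite subr0 mulr1 /q.
have -> : dot (grad f (x + t *: h)) h - (dot (grad f x) h + L * norm2 h ^+ 2 * t) =
  dot (grad f (x + t *: h) - grad f x) h - L * norm2 h ^+ 2 * t.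
  by rewrite dotBl; ring.
have := cauchy_schwarz (grad f (x + t *: h) - grad f x) h.
have /(ler_wpM2r (norm2_ge0 h)) := Lf (x + t *: h) x.
rewrite addrAC subrr add0r norm2Z (gtr0_norm t0) scale1r scale0r addr0.
lra.
Qed.

Lemma convex_line f x y (t : R) :
  convex_function (setT : set (convex_lmodType 'rV[R]_d)) f ->
  0 <= t <= 1 -> f (x + t *: (y - x)) <= f x + t * (f y - f x).
Proof.
move=> cf /andP[t0 t1].
have := cf (Itv01 t0 t1) y x; rewrite !inE => /(_ Logic.I Logic.I).
rewrite /conv/= [X in f X](_ : _ = x + t *: (y - x)).
  move=> /le_trans; apply.
  rewrite [leLHS](_ : _ = t * f y + (1 - t) * f x)//; lra.
by rewrite /unstable.onem scalerBl scale1r scalerBr addrCA.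
Qed.

(** By convexity the difference quotients from [x] towards [y] with [0 < t <= 1] are at most
    [f y - f x]; the right-hand limit at 0 keeps the bound. *)
Lemma convex_grad_le f x y : differentiable f x ->
  convex_function (setT : set (convex_lmodType 'rV[R]_d)) f ->
  f x + dot (grad f x) (y - x) <= f y.
Proof.
move=> df cf; rewrite -lerBrDl -derive_dot_grad//.
have /cvg_dnbhs_at_right cvg_quot := diff_derivable (v := y - x) df.
rewrite /derive; have /cvg_lim <- := cvg_quot => //.
apply: limr_le; first exact: cvgP cvg_quot.
near=> t; have t0 : 0 < t by near: t; exact: nbhs_right_gt.
have t1 : t <= 1 by near: t; exact: nbhs_right_ltW.
rewrite /GRing.scale/= ler_pdivrMl// lerBlDl [_ + x]addrC.
by apply: convex_line; rewrite // t1 ltW.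
Unshelve. all: by end_near. Qed.
End euclidean_lemmas.

(** * Equivalence of norms, bounded sublevel sets and finiteness of the radius *)

Section sublevel_sets.
Context {R : realType} {d : nat}.
Implicit Types (u v w x y : 'rV[R]_d) (f N : 'rV[R]_d -> R).

Lemma coord_le_norm v i : `|v 0 i| <= `|v|.
Proof.
by rewrite [leRHS]/Num.Def.normr /= mx_normrE; apply/bigmax_geP; right => /=; exists (0, i).
Qed.

Lemma dot_le_norm u v : dot u v <= d%:R * (`|u| * `|v|).
Proof.
rewrite /dot mulr_natl -[X in _ *+ X]card_ord -sumr_const.
apply: ler_sum => i _; rewrite (le_trans (ler_norm _))// normrM.
by apply: ler_pM => //; exact: coord_le_norm.
Qed.

Lemma compact_sphere (r : R) : compact [set v : 'rV[R]_d | `|v| = r].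
Proof.
apply: bounded_closed_compact.
  by exists r; split; [exact: num_real|move=> M rM v /= ->; exact: ltW].
rewrite (_ : mkset _ = (fun v : 'rV[R]_d => `|v|) @^-1` [set r])//.
apply: preimage_closed; last exact: closed_eq.
by move=> v _; exact: norm_continuous.
Qed.

Lemma rescale_norm (r : R) v : 0 <= r -> v != 0 -> `|(r / `|v|) *: v| = r.
Proof.
move=> r0 v0; rewrite normrZ ger0_norm ?divr_ge0// divfK//.
by rewrite normr_eq0.
Qed.

Lemma is_norm0 N : is_norm N -> N 0 = 0.
Proof. by move=> nN; rewrite -(scale0r (0 : 'rV[R]_d)) norm_scale// normr0 mul0r. Qed.

Lemma is_norm_le_norm N : is_norm N -> exists K, forall v, N v <= K * `|v|.
Proof.
move=> nN; exists (\sum_(i < d) N (delta_mx 0 i)) => v.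
rewrite [in leLHS](row_sum_delta v) mulr_suml.
elim/big_ind2 : _ => [|a a' b b' le_a le_b|i _]; first by rewrite is_norm0.
  by rewrite (le_trans (norm_triangle nN _ _))// lerD.
by rewrite norm_scale// mulrC ler_wpM2l ?norm_ge0// coord_le_norm.
Qed.

Lemma lipschitz_bound_continuous f (K : R) :
  (forall x y, f x - f y <= K * `|x - y|) -> continuous f.
Proof.
move=> fK x; apply/(@cvgrPdist_le _ _ _ (nbhs x) _ f (f x)) => e e0.
(* [K] may be zero or negative, so [|K| + 1] serves as a positive Lipschitz constant. *)
have K1 : 0 < `|K| + 1 by rewrite ltr_wpDl.
have FF : Filter (nbhs x) by exact: nbhs_filter.
have := @cvgr_dist_le _ _ _ (nbhs x) FF id x cvg_id (e / (`|K| + 1)).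
rewrite divr_gt0// => /(_ isT); apply: filterS => y /= xy.
have Kxy : K * `|x - y| <= e.
  apply: (@le_trans _ _ ((`|K| + 1) * `|x - y|)).
    by rewrite ler_wpM2r// (le_trans (ler_norm _))// lerDl.
  by rewrite mulrC -ler_pdivlMr.
by rewrite ler_norml lerNl opprB !(le_trans (fK _ _))// distrC.
Qed.

Lemma is_norm_continuous N : is_norm N -> continuous N.
Proof.
move=> nN; have [K NK] := is_norm_le_norm nN.
apply: (lipschitz_bound_continuous (K := K)) => u v; rewrite lerBlDl.
by rewrite -{1}(subrK v u) addrC (le_trans (norm_triangle nN _ _))// lerD2l.
Qed.

(** The constant is the minimum of [N] on the compact unit sphere of the sup norm, positive by
    definiteness, and scaling extends the bound to all vectors. If the sphere is empty, 0 is the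
    only vector and any constant works. *)
Lemma norm_le_is_norm N : is_norm N ->
  exists2 c, 0 < c & forall v, c * `|v| <= N v.
Proof.
move=> nN; have [sph|nosph] := pselect ([set v : 'rV[R]_d | `|v| = 1] !=set0).
  have [|v0] := EVT_min_rV sph (@compact_sphere 1) (f := N).
    by apply: continuous_subspaceT; exact: is_norm_continuous.
  rewrite inE/= => v01 minN; exists (N v0).
    rewrite lt_neqAle norm_ge0// andbT eq_sym; apply/eqP => /(norm_eq0 nN) v00.
    by move: v01; rewrite v00 normr0 => /esym/eqP; rewrite oner_eq0.
  move=> v; have [->|v_neq0] := eqVneq v 0; first by rewrite normr0 mulr0 norm_ge0.
  have v_gt0 : 0 < `|v| by rewrite normr_gt0.
  have := minN ((1 / `|v|) *: v); rewrite inE/= rescale_norm// => /(_ erefl).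
  by rewrite norm_scale// div1r gtr0_norm ?invr_gt0// ler_pdivlMl// mulrC.
exists 1 => // v; have [->|v_neq0] := eqVneq v 0.
  by rewrite normr0 mulr0 norm_ge0.
by exfalso; apply: nosph; exists ((1 / `|v|) *: v); exact: rescale_norm.
Qed.

(** On a large enough sphere around [c] the minimum [m] of [f] exceeds [f c]. By convexity [f] grows
    at least linearly along rays beyond that sphere, at rate [(m - f c) / r], so every level is
    reached within a bounded distance. *)
Lemma convex_sublevel_bounded f (b : R) : continuous f ->
  convex_function (setT : set (convex_lmodType 'rV[R]_d)) f ->
  (exists c, bounded_set [set x | f x <= f c]) ->
  exists M, forall x, f x <= b -> `|x| <= M.
Proof.
move=> ctf cf [c [B [_ fB]]].
(* The sublevel set of [c] lies in the ball of radius [|B| + 1] about the origin; a point at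
   distance [r] from [c] has norm at least [|B| + 2]. *)
set r := `|B| + 1 + `|c| + 1.
have r_gt0 : 0 < r by rewrite /r ltr_wpDl// !addr_ge0.
have r_ge0 := ltW r_gt0.
have far v : `|v| = r -> f c < f (c + v).
  move=> vr; rewrite ltNge; apply/negP => /(fB (`|B| + 1)) /=.
  rewrite (le_lt_trans (ler_norm _) _) ?ltrDl// => /(_ isT).
  have := ler_normB (c + v) c; rewrite addrAC subrr add0r vr /r; lra.
have [sph|nosph] := pselect ([set v : 'rV[R]_d | `|v| = r] !=set0); last first.
  exists `|c| => x _; have [->//|xc] := eqVneq x c.
  exfalso; apply: nosph; exists ((r / `|x - c|) *: (x - c)).
  by rewrite /= rescale_norm// subr_eq0.
have [|v0] := EVT_min_rV sph (@compact_sphere r) (f := fun v => f (c + v)).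
  apply: continuous_subspaceT => v; apply: continuous_comp; last exact: ctf.
  by apply: (@cvgD _ 'rV[R]_d _ (nbhs v) _ (cst c) id c v);
    [exact: cvg_cst|exact: cvg_id].
rewrite inE/= => /far fcv0 minf; set m := f (c + v0) in fcv0 minf.
(* The summands handle the points outside the sphere, those inside it, and the move of the centre
   from [c] to the origin. *)
exists (r * `|b - f c| / (m - f c) + r + `|c|) => x fxb.
have gap : 0 < m - f c by rewrite subr_gt0.
rewrite -{1}(subrK c x) (le_trans (ler_normD _ _))// lerD2r.
have [xc|xc] := leP `|x - c| r.
  by apply: ler_wpDl => //; rewrite divr_ge0 ?mulr_ge0// ltW.
have xc_gt0 : 0 < `|x - c| by exact: lt_trans xc.
apply: ler_wpDr; first exact: ltW.
rewrite ler_pdivlMr//.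
have xc0 : x - c != 0 by rewrite -normr_gt0.
have t0 : 0 <= r / `|x - c| by rewrite divr_ge0.
have t01 : 0 <= r / `|x - c| <= 1 by rewrite t0/= ler_pdivrMr// mul1r ltW.
(* The segment from [c] to [x] meets the sphere at parameter [r / |x - c|], where [f] is at least
   [m]. *)
have := minf ((r / `|x - c|) *: (x - c)).
rewrite inE/= rescale_norm// => /(_ erefl)/le_trans/(_ (convex_line c x cf t01)).
rewrite -lerBlDl => mle; rewrite mulrC -ler_pdivlMr// mulrAC (le_trans mle)//.
by rewrite ler_wpM2l// (le_trans _ (ler_norm _))// lerD2r.
Qed.

Lemma sublevel_radius_fin_num f N (theta_star theta1 : 'rV[R]_d) :
  (0 < d)%N -> is_norm N -> continuous f ->
  convex_function (setT : set (convex_lmodType 'rV[R]_d)) f ->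
  (exists c, bounded_set [set x | f x <= f c]) ->
  sublevel_radius f theta_star N theta1 \is a fin_num.
Proof.
move=> d_gt0 nN ctf cf bf.
have [c c_gt0 cN] := norm_le_is_norm nN.
have [M fM] := convex_sublevel_bounded (f theta1) ctf cf bf.
have [e e0] : exists e : 'rV[R]_d, e != 0.
  exists (delta_mx 0 (Ordinal d_gt0)); apply/matrix0Pn.
  by exists 0, (Ordinal d_gt0); rewrite mxE !eqxx oner_eq0.
rewrite fin_numElt; apply/andP; split.
  (* A single real member, from [theta1] and a nonzero [e], keeps the supremum above -oo. Such an
     [e] exists because [d > 0]. *)
  rewrite (@lt_le_trans _ _ (dot e (theta1 - theta_star) / N e)%:E) ?ltNyr//.
  apply: le_trans (ereal_sup_ubound _); last by exists theta1 => //=.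
  by apply: ereal_sup_ubound; exists e.
(* Each quotient is bounded using [<v, y> <= d |v| |y|], [|theta| <= M] on the sublevel set, and
   [c |v| <= N v]. *)
apply: (@le_lt_trans _ _ (d%:R * (M + `|theta_star|) / c)%:E); last exact: ltry.
apply: ge_ereal_sup => _ [x /= /fM xM <-]; apply: ge_ereal_sup => _ [v /= v0 <-].
have v_gt0 : 0 < `|v| by rewrite normr_gt0.
have Nv_gt0 : 0 < N v by rewrite (lt_le_trans _ (cN v))// mulr_gt0.
rewrite lee_fin ler_pdivrMr// (le_trans (dot_le_norm _ _))//.
rewrite -!mulrA ler_wpM2l// (@le_trans _ _ ((M + `|theta_star|) * `|v|))//.
  rewrite mulrC ler_wpM2r// (le_trans (ler_normB _ _))// lerD2r//.
rewrite ler_wpM2l ?addr_ge0 ?(le_trans _ xM)//.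
by rewrite mulrC ler_pdivlMr// mulrC.
Qed.
End sublevel_sets.

(** * Independence: from rectangles to joint events and iterated integrals *)

Section independence.
Context d d1 d2 (Omega : measurableType d) (T1 : measurableType d1)
  (T2 : measurableType d2) (R : realType) (P : probability Omega R).

(** A pi-system argument: the law of [(X, Y)] restricted to [E] and the law of [(X, Y)] scaled by
    [P E] are finite measures that agree on measurable rectangles, hence everywhere. *)
Lemma independent_pair_event (X : Omega -> T1) (Y : Omega -> T2) (E : set Omega) :
  measurable_fun setT X -> measurable_fun setT Y -> measurable E ->
  (forall A B, measurable A -> measurable B ->
    P (X @^-1` A `&` Y @^-1` B `&` E) = (P (X @^-1` A `&` Y @^-1` B) * P E)%E) ->
  forall C, measurable C ->
    P ((fun w => (X w, Y w)) @^-1` C `&` E) =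
    (P ((fun w => (X w, Y w)) @^-1` C) * P E)%E.
Proof.
move=> mX mY mE indep C mC.
have mXY : measurable_fun setT (fun w => (X w, Y w)) by exact: measurable_fun_pair.
pose m1 : {measure set (T1 * T2) -> \bar R} :=
  measure_function_pushforward__canonical__measure_function_Measure (mrestr P mE) mXY.
have PE0 : 0 <= fine (P E) by rewrite fine_ge0.
pose m2 : {measure set (T1 * T2) -> \bar R} := mscale (NngNum PE0)
  (measure_function_pushforward__canonical__measure_function_Measure P mXY).
have m2E A : m2 A = (P ((fun w => (X w, Y w)) @^-1` A) * P E)%E.
  by rewrite /m2/= /mscale/= fineK ?fin_num_measure// muleC.
rewrite -m2E; change (m1 C = m2 C).
apply: (measure_unique [set A `*` B | A in measurable & B in measurable]
  (fun=> setT)) => //.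
- exact: measurable_prod_measurableType.
- move=> _ _ [A mA [B mB <-]] [A' mA' [B' mB' <-]].
  exists (A `&` A'); first exact: measurableI.
  by exists (B `&` B'); [exact: measurableI|rewrite setXI].
- by move=> _; exists setT => //; exists setT => //; rewrite setXTT.
- by rewrite bigcup_const//; exists 0%N.
- by move=> _ [A mA [B mB <-]]; rewrite m2E; exact: indep.
- by move=> _; rewrite /m1/= /pushforward /mrestr preimage_setT setTI ltey_eq fin_num_measure.
Qed.

(** The hypothesis on rectangles identifies the joint law with the product of the law of [X] and
    [Q]; Tonelli then gives the iterated integral. This plays the part of conditioning on [X]. *)
Lemma ge0_integral_independent (X : {RV P >-> T1}) (Y : {RV P >-> T2})
    (Q : probability T2 R) (g : T1 * T2 -> \bar R) :
  (forall A B, measurable A -> measurable B ->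
    P (X @^-1` A `&` Y @^-1` B) = (P (X @^-1` A) * Q B)%E) ->
  measurable_fun setT g -> (forall z, 0 <= g z)%E ->
  (\int[P]_w g (X w, Y w) = \int[P]_w \int[Q]_y g (X w, y))%E.
Proof.
move=> indep mg g0.
have mXY : measurable_fun setT (fun w => (X w, Y w)) by exact: measurable_fun_pair.
pose Z : {RV P >-> (T1 * T2)%type} := mfun_Sub (mem_set mXY).
rewrite -[LHS](ge0_integral_distribution Z mg g0).
transitivity (\int[distribution P X \x Q]_z g z)%E.
  apply: eq_measure_integral => C mC _.
  apply/esym; apply: product_measure_unique => // A B mA mB; exact: indep.
rewrite fubini_tonelli1// (ge0_integral_distribution X)//.
  exact: measurable_fun_fubini_tonelli_F.
by move=> x; apply: integral_ge0 => y _; exact: g0.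
Qed.
End independence.

(** * Independence of each iterate from the present and future directions *)

Section stp_independence.
Context {R : realType} {d : nat}.
Variables (f : 'rV[R]_d -> R) (alpha : nat -> R) (D : probability 'rV[R]_d R)
  (theta1 : 'rV[R]_d) (dO : measure_display) (Omega : measurableType dO)
  (P : probability Omega R) (s : nat -> {RV P >-> 'rV[R]_d})
  (theta : nat -> Omega -> 'rV[R]_d).
Hypothesis stpP : stp f alpha D theta1 s theta.

Let measurable_preimage_s (J : {fset nat}) (A : nat -> set 'rV[R]_d) :
  (forall i, i \in J -> measurable (A i)) ->
  measurable (\bigcap_(i in [set` J]) (s i @^-1` A i)).
Proof.
move=> mA; apply: fin_bigcap_measurable; first exact: finite_fset.
by move=> i iJ; apply: measurable_funPTI; exact: mA.
Qed.

(* The induction needs independence from all directions from time t on jointly: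
   theta^t is independent of s_t only because theta^(t-1) is independent of the
   pair (s_(t-1), s_t), and so on. *)
Lemma stp_iterate_independent t : (0 < t)%N ->
  measurable_fun setT (theta t) /\
  forall (J : {fset nat}) (A : nat -> set 'rV[R]_d) B,
    (forall i, i \in J -> (t <= i)%N) ->
    (forall i, i \in J -> measurable (A i)) -> measurable B ->
    P (theta t @^-1` B `&` \bigcap_(i in [set` J]) (s i @^-1` A i)) =
    (P (theta t @^-1` B) * P (\bigcap_(i in [set` J]) (s i @^-1` A i)))%E.
Proof.
elim: t => // -[_ _|t IH _].
  have -> : theta 1 = cst theta1 by apply/funext => w; exact: stp_init stpP w.
  split; first exact: measurable_cst.
  move=> J A B _ mA mB; rewrite preimage_cst.
  case: ifPn => _; first by rewrite setTI probability_setT mul1e.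
  by rewrite set0I measure0 mul0e.
have [mt indep] := IH isT.
have [step stepP iter] := stp_iter stpP.
have [mstep _] := stepP _ (ltn0Sn t).
have thetaE : theta t.+2 = (fun p => step t.+1 p.1 p.2) \o
    (fun w => (theta t.+1 w, s t.+1 w)) by apply/funext => w; exact: iter.
have mpair : measurable_fun setT (fun w => (theta t.+1 w, s t.+1 w)).
  by apply: measurable_fun_pair.
split; first by rewrite thetaE; exact: measurableT_comp.
move=> J A B Jt mA mB; rewrite thetaE comp_preimage.
apply: independent_pair_event => //; last first.
- by rewrite -[X in measurable X]setTI; exact: mstep.
- move=> B1 B2 mB1 mB2.
  (* Adding the index [t.+1] to [J] turns the event on the current direction into one more factor of
     the intersection, so the induction hypothesis applies to the enlarged family. *)
  pose A' i := if i == t.+1 then B2 else A i.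
  have tJ : t.+1 \notin J by apply/negP => /Jt; rewrite ltnn.
  have A'J i : i \in J -> A' i = A i.
    by move=> iJ; rewrite /A'; case: eqP => // it; rewrite -it iJ in tJ.
  have A't : A' t.+1 = B2 by rewrite /A' eqxx.
  have capU : \bigcap_(i in [set` (t.+1 |` J)%fset]) (s i @^-1` A' i) =
      s t.+1 @^-1` B2 `&` \bigcap_(i in [set` J]) (s i @^-1` A i).
    rewrite set_fsetU set_fset1 bigcap_setU1 A't; congr (_ `&` _).
    by apply: eq_bigcapr => i iJ; rewrite A'J.
  have cap1 : \bigcap_(i in [set` [fset t.+1]%fset]) (s i @^-1` A' i) =
      s t.+1 @^-1` B2 by rewrite set_fset1 bigcap_set1 A't.
  have mA' i : i \in (t.+1 |` J)%fset -> measurable (A' i).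
    by rewrite !inE => /orP[/eqP ->|iJ]; rewrite ?A't// A'J//; exact: mA.
  have sIndep : P (s t.+1 @^-1` B2 `&` \bigcap_(i in [set` J]) (s i @^-1` A i)) =
      (P (s t.+1 @^-1` B2) * P (\bigcap_(i in [set` J]) (s i @^-1` A i)))%E.
    rewrite -capU (stp_indep stpP) ?(stp_indep stpP)//.
    + rewrite big_fsetU1//= A't; congr (_ * _)%E.
      by rewrite big_seq [RHS]big_seq; apply: eq_bigr => i iJ; rewrite A'J.
    + by move=> i /= /Jt; exact: leq_trans.
    + by move=> i /=; rewrite !inE => /orP[/eqP ->//|/Jt]; exact: leq_trans.
  rewrite -setIA -capU indep//; last first.
    by move=> i; rewrite !inE => /orP[/eqP ->//|/Jt]; exact: ltnW.
  rewrite -[in RHS]cap1 indep//; last 2 first.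
    by move=> i; rewrite !inE => /eqP ->.
    by move=> i; rewrite !inE => /eqP ->; rewrite A't.
  by rewrite capU cap1 sIndep muleA.
- exact: measurable_preimage_s.
Qed.

Lemma stp_pair_law t A B : (0 < t)%N -> measurable A -> measurable B ->
  P (theta t @^-1` A `&` s t @^-1` B) = (P (theta t @^-1` A) * D B)%E.
Proof.
move=> t0 mA mB; have [_ indep] := stp_iterate_independent t0.
rewrite -(stp_law stpP t0 mB).
have := indep [fset t]%fset (fun=> B) A; rewrite set_fset1 bigcap_set1; apply => //.
by move=> i; rewrite inE => /eqP ->.
Qed.
End stp_independence.

(** * Borel measurability of norms, gradients and slopes *)

Section borel_measurability.
Context {R : realType} {d : nat}.
Implicit Types (v x y : 'rV[R]_d) (f : 'rV[R]_d -> R).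

Lemma continuous_measurable_rV f : continuous f -> measurable_fun setT f.
Proof.
move=> /continuousP cf; apply: (measurability _ (RGenOInfty.measurableE R)).
move=> _ [_ [a ->] <-]; rewrite setTI; apply: sub_sigma_algebra.
exact/cf/interval_open.
Qed.

Lemma measurable_coord i : measurable_fun setT (fun v : 'rV[R]_d => v 0 i).
Proof. by apply: continuous_measurable_rV => v; exact: coord_continuous. Qed.

Lemma measurable_norm2 : measurable_fun setT (@norm2 R d).
Proof.
apply: (@measurableT_comp _ _ _ _ _ _ (@Num.sqrt R)).
  by apply: continuous_measurable_fun; exact: sqrt_continuous.
apply: measurable_sum => i.
by apply: measurable_funX; exact: measurable_coord.
Qed.

Lemma norm2_le_norm v : norm2 v <= Num.sqrt d%:R * `|v|.
Proof.
rewrite -(normr_id v) -sqrtr_sqr -sqrtrM ?ler0n// ler_wsqrtr//.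
rewrite (le_trans _ (dot_le_norm v v))// /dot; exact: ler_sum.
Qed.

Lemma coord_le_norm2 v i : v 0 i <= norm2 v.
Proof.
rewrite (le_trans (ler_norm _))// -sqrtr_sqr ler_wsqrtr//.
by rewrite (bigD1 i)//= lerDl sumr_ge0// => j _; exact: sqr_ge0.
Qed.

Lemma smooth_grad_continuous (L : R) f i : smooth L f ->
  continuous (fun x => grad f x 0 i).
Proof.
move=> Lf; apply: (lipschitz_bound_continuous (K := `|L| * Num.sqrt d%:R)) => x y.
have -> : grad f x 0 i - grad f y 0 i = (grad f x - grad f y) 0 i by rewrite !mxE.
rewrite (le_trans (coord_le_norm2 _ _))// (le_trans (Lf x y))// -mulrA.
rewrite (@le_trans _ _ (`|L| * norm2 (x - y)))//.
  by rewrite ler_wpM2r ?norm2_ge0// ler_norm.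
by rewrite ler_wpM2l// norm2_le_norm.
Qed.

(** Joint measurability in the point and the direction is what Tonelli requires for the expected
    slope. *)
Lemma measurable_dot_grad (L : R) f : smooth L f ->
  measurable_fun setT (fun p : 'rV[R]_d * 'rV[R]_d => dot (grad f p.1) p.2).
Proof.
move=> Lf; apply: measurable_sum => i; apply: measurable_funM.
  apply: (measurableT_comp (f := fun x => grad f x 0 i)) => //.
  by apply: continuous_measurable_rV; exact: smooth_grad_continuous Lf.
by apply: (measurableT_comp (f := fun x : 'rV[R]_d => x 0 i)) => //; exact: measurable_coord.
Qed.

End borel_measurability.

(** For [t >= b] the factor [1 - b/t] is nonnegative, so the induction hypothesis can be inserted;
    with [c <= a (b - 1)] the right side becomes at most [a (t - 1) / t^2], which is below
    [a / (t + 1)] because [(t - 1)(t + 1) <= t^2]. The bound by [m] covers the smaller indices. *)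
Lemma harmonic_recursion (R : realFieldType) (e : nat -> R) (a b c m : R) :
  1 < b -> (forall t, (0 < t)%N -> 0 <= e t <= m) ->
  3 * b * m <= a -> c <= a * (b - 1) ->
  (forall t, (0 < t)%N -> e t.+1 <= (1 - b / t%:R) * e t + c / t%:R ^+ 2) ->
  forall t, (0 < t)%N -> e t <= a / t%:R.
Proof.
move=> b1 em ma ca rec; elim=> // -[_ _|t IH _].
  have /andP[e0 e1] := em 1%N isT; rewrite divr1; nra.
have /andP[e0 e1] := em t.+2 isT.
have T0 : 0 < t.+1%:R :> R by rewrite ltr0n.
have T1 : 1 <= t.+1%:R :> R by rewrite ler1n.
have -> : t.+2%:R = t.+1%:R + 1 :> R by rewrite -natr1.
move: (rec t.+1 isT) (IH isT) T0 T1; set x : R := t.+1%:R => rect IHt T0 T1.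
have [xb|bx] := ltP x b.
  (* 1 - b/t may be very negative here, but then t + 1 < 3 b and the a priori
     bound e <= m <= a / (3 b) is enough. *)
  rewrite ler_pdivlMr; last by lra.
  by rewrite (le_trans _ ma)//; nra.
have bx1 : 0 <= 1 - b / x by rewrite subr_ge0 ler_pdivrMr// mul1r.
have a0 : 0 <= a by have := em 1%N isT; nra.
rewrite (le_trans rect)// (@le_trans _ _ ((1 - b / x) * (a / x) + a * (b - 1) / x ^+ 2))//.
  by rewrite lerD// ?ler_wpM2l// ler_wpM2r// invr_ge0 exprn_ge0// ltW.
have -> : (1 - b / x) * (a / x) + a * (b - 1) / x ^+ 2 = a * ((x - 1) / x ^+ 2).
  by field; rewrite gt_eqF.
rewrite ler_wpM2l// ler_pdivrMr ?exprn_gt0// mulrC ler_pdivlMr; first by lra.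
by rewrite addr_gt0.
Qed.

(** * Consequences of the assumptions on the objective *)

Section objective_bounds.
Context {R : realType} {d : nat}.
Variables (f : 'rV[R]_d -> R) (L : R) (theta_star : 'rV[R]_d).
Hypothesis objP : objective f L theta_star.

Lemma objective_ge x : f theta_star <= f x.
Proof.
by rewrite -lee_fin (objective_min objP); apply: ereal_inf_lbound; exists x.
Qed.

Lemma objective_continuous : continuous f.
Proof.
by move=> x; apply: differentiable_continuous; exact: objective_differentiable objP x.
Qed.

(** In dimension 0 there is no nonzero vector, so every dual norm, and with it the radius, is
    -oo. *)
Lemma sublevel_radius_real_dim_gt0 (N : 'rV[R]_d -> R) theta1 r :
  sublevel_radius f theta_star N theta1 = r%:E -> (0 < d)%N.
Proof.
rewrite lt0n => rE; apply/negP => /eqP d0.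
have : (sublevel_radius f theta_star N theta1 <= -oo)%E; last by rewrite rE.
apply: ge_ereal_sup => _ [x _ <-]; apply: ge_ereal_sup => _ [v /= /matrix0Pn[_ [j _]] <-].
by exfalso; have := leq_ltn_trans (leq0n j) (ltn_ord j); rewrite d0.
Qed.

Lemma smooth_ge0 : (0 < d)%N -> 0 <= L.
Proof.
move=> d_gt0; pose e : 'rV[R]_d := delta_mx 0 (Ordinal d_gt0).
have := le_trans (norm2_ge0 _) (objective_smooth objP e 0).
rewrite subr0 pmulr_lge0// (lt_le_trans _ (coord_le_norm2 e (Ordinal d_gt0)))//.
by rewrite mxE !eqxx ltr01.
Qed.

(** Convexity bounds the gap by [<grad f x, x - theta_star>]. Testing the dual norm of
    [x - theta_star] on the vector [grad f x] itself bounds this by [r N (grad f x)]. A zero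
    gradient, excluded from the supremum, is treated apart. *)
Lemma gap_le_grad_norm (N : 'rV[R]_d -> R) theta1 r x : is_norm N ->
  sublevel_radius f theta_star N theta1 = r%:E -> f x <= f theta1 ->
  f x - f theta_star <= r * N (grad f x).
Proof.
move=> nN rE xtheta1.
have dotN : dot (grad f x) (theta_star - x) = - dot (grad f x) (x - theta_star).
  by rewrite -dotNr opprB.
have := convex_grad_le theta_star (objective_differentiable objP x)
  (objective_convex objP).
rewrite dotN => gap; rewrite (@le_trans _ _ (dot (grad f x) (x - theta_star)))//.
  lra.
have [g0|g0] := eqVneq (grad f x) 0.
  by rewrite g0 is_norm0// mulr0 /dot big1// => i _; rewrite mxE mul0r.
have Ng : 0 < N (grad f x).
  rewrite lt_neqAle norm_ge0// andbT eq_sym; apply: contra_neq g0.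
  exact: norm_eq0.
rewrite -ler_pdivrMr// -lee_fin -rE.
apply: (@le_trans _ _ (dual_norm N (x - theta_star))).
  by apply: ereal_sup_ubound; exists (grad f x).
by apply: ereal_sup_ubound; exists x.
Qed.
End objective_bounds.

(** * One-step analysis of STP and the resulting rate *)

Section stp_rate.
Context {R : realType} {d : nat}.
Variables (f : 'rV[R]_d -> R) (L : R) (theta_star : 'rV[R]_d)
  (D : probability 'rV[R]_d R) (N : 'rV[R]_d -> R) (mu : R)
  (theta1 : 'rV[R]_d) (r : R) (alpha : nat -> R)
  (dO : measure_display) (Omega : measurableType dO)
  (P : probability Omega R) (s : nat -> {RV P >-> 'rV[R]_d})
  (theta : nat -> Omega -> 'rV[R]_d).
Hypotheses (objP : objective f L theta_star)
  (distP : search_distribution D N mu)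
  (rE : sublevel_radius f theta_star N theta1 = r%:E) (r_gt0 : 0 < r)
  (stpP : stp f alpha D theta1 s theta).

Lemma stp_decrease t w : (0 < t)%N ->
  [/\ f (theta t.+1 w) <= f (theta t w),
      f (theta t.+1 w) <= f (theta t w + alpha t *: s t w) &
      f (theta t.+1 w) <= f (theta t w - alpha t *: s t w)].
Proof.
move=> t0; have [step stepP iter] := stp_iter stpP.
rewrite iter//; have [_ /(_ (theta t w) (s t w))[_ minstep]] := stepP t t0.
by split; apply: minstep => /=; [left; left|left; right|right].
Qed.

(** Iterates stay surely in the initial sublevel set, so the radius controls all of them and the
    gaps are bounded. *)
Lemma stp_sublevel t w : (0 < t)%N -> f (theta t w) <= f theta1.
Proof.
elim: t => // -[_ _|t IH _]; first by rewrite (stp_init stpP).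
by have [le_t _ _] := stp_decrease w (ltn0Sn t); rewrite (le_trans le_t) ?IH.
Qed.

Lemma stp_step_decrease t w : (0 < t)%N -> norm2 (s t w) <= 1 ->
  f (theta t.+1 w) + alpha t * `|dot (grad f (theta t w)) (s t w)| <=
  f (theta t w) + L * alpha t ^+ 2 / 2.
Proof.
move=> t0 s1; have [_ le_plus le_minus] := stp_decrease w t0.
have at0 := stp_alpha_gt0 stpP t0.
have L0 := smooth_ge0 objP (sublevel_radius_real_dim_gt0 rE).
have descent h : norm2 h <= alpha t ->
    f (theta t w + h) <=
    f (theta t w) + dot (grad f (theta t w)) h + L * alpha t ^+ 2 / 2.
  move=> ha; rewrite (le_trans (descent_lemma _ _
    (objective_differentiable objP) (objective_smooth objP)))//.
  rewrite lerD2l mulrAC ler_wpM2r ?invr_ge0// ler_wpM2l//.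
  by rewrite lerXn2r// ?nnegrE ?norm2_ge0// ltW.
have sa : norm2 (alpha t *: s t w) <= alpha t.
  by rewrite norm2Z gtr0_norm// ler_piMr// ltW.
have dplus := descent _ sa.
have := descent (- (alpha t *: s t w)); rewrite -scaleNr norm2Z normrN -norm2Z.
move=> /(_ sa); rewrite scaleNr dotNr dotZr => dminus.
move: dplus; rewrite dotZr => dplus.
(* The minus candidate gives the bound when the slope is nonnegative, the plus candidate when it is
   negative. *)
by case: ger0P => _; lra.
Qed.

Let integral_const (c : R) : (\int[P]_w c%:E = c%:E)%E.
Proof. by have := expectation_cst P c; rewrite unlock. Qed.

Let gap t w := f (theta t w) - f theta_star.

Let gap_ge0 t w : 0 <= gap t w.
Proof. by rewrite subr_ge0 (objective_ge objP). Qed.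

Let measurable_theta t : (0 < t)%N -> measurable_fun setT (theta t).
Proof. by move=> t0; have [] := stp_iterate_independent stpP t0. Qed.

Let measurable_f_theta t : (0 < t)%N -> measurable_fun setT (f \o theta t).
Proof.
move=> t0; apply: measurableT_comp; last exact: measurable_theta.
by apply: continuous_measurable_rV; exact: objective_continuous objP.
Qed.

Let measurable_gap t : (0 < t)%N -> measurable_fun setT (fun w => (gap t w)%:E).
Proof.
move=> t0; apply/measurable_EFinP; apply: measurable_funB => //.
exact: measurable_f_theta.
Qed.

Let measurable_slope t : (0 < t)%N ->
  measurable_fun setT (fun w => `|dot (grad f (theta t w)) (s t w)|%:E).
Proof.
move=> t0; apply/measurable_EFinP; apply: measurableT_comp => //.
apply: (measurableT_comp (measurable_dot_grad (objective_smooth objP))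
  (g := fun w => (theta t w, s t w))).
by apply: measurable_fun_pair => //; exact: measurable_theta.
Qed.

Lemma stp_expected_slope t : (0 < t)%N ->
  ((mu / r)%:E * \int[P]_w (gap t w)%:E <=
   \int[P]_w `|dot (grad f (theta t w)) (s t w)|%:E)%E.
Proof.
move=> t0; have mu0 := search_mu_gt0 distP.
pose X : {RV P >-> 'rV[R]_d} := mfun_Sub (mem_set (measurable_theta t0)).
have mslope : measurable_fun setT
    (fun p : 'rV[R]_d * 'rV[R]_d => `|dot (grad f p.1) p.2|%:E).
  apply/measurable_EFinP; apply: measurableT_comp => //.
  exact: measurable_dot_grad (objective_smooth objP).
rewrite (ge0_integral_independent (X := X) (Y := s t) (Q := D)
  (g := fun p => `|dot (grad f p.1) p.2|%:E))//; last first.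
  by move=> A B mA mB; exact: (stp_pair_law stpP).
rewrite -ge0_integralZl_EFin//; last 3 first.
- by move=> w _; rewrite lee_fin gap_ge0.
- exact: measurable_gap.
- by rewrite divr_ge0// ltW.
apply: ge0_le_integral => //.
- by move=> w _; rewrite -EFinM lee_fin mulr_ge0 ?gap_ge0// divr_ge0// ltW.
- by apply: measurable_funeM; exact: measurable_gap.
- apply: (measurableT_comp (f := fun x => (\int[D]_y `|dot (grad f x) y|%:E)%E)).
    exact: (measurable_fun_fubini_tonelli_F (m2 := D) _ mslope).
  exact: measurable_theta.
(* With the iterate frozen, the inner integral over [D] is at least [mu N (grad f)], hence at least
   [mu / r] times the gap. *)
move=> w _; have := search_lower distP (grad f (theta t w)).
rewrite unlock; apply: le_trans; rewrite -EFinM lee_fin.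
have := gap_le_grad_norm objP (search_norm distP) rE (stp_sublevel w t0).
by rewrite -ler_pdivrMl// -mulrA ler_pM2l// /gap.
Qed.

(** The slope term stays on the left so that all integrands are nonnegative and no integrability is
    required. The pointwise inequality holds off the null event [|s_t|_2 > 1], whence the
    almost-everywhere comparison. *)
Lemma stp_expected_decrease t : (0 < t)%N ->
  (\int[P]_w (gap t.+1 w)%:E +
   (alpha t)%:E * \int[P]_w `|dot (grad f (theta t w)) (s t w)|%:E <=
   \int[P]_w (gap t w)%:E + (L * alpha t ^+ 2 / 2)%:E)%E.
Proof.
move=> t0; have at0 := ltW (stp_alpha_gt0 stpP t0).
have L0 := smooth_ge0 objP (sublevel_radius_real_dim_gt0 rE).
have c0 : 0 <= L * alpha t ^+ 2 / 2 by rewrite divr_ge0// mulr_ge0// exprn_ge0.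
rewrite -ge0_integralZl_EFin//; last exact: measurable_slope.
rewrite -ge0_integralD//; last 4 first.
- by move=> w _; rewrite lee_fin gap_ge0.
- exact: measurable_gap.
- by move=> w _; rewrite -EFinM lee_fin mulr_ge0.
- by apply: measurable_funeM; exact: measurable_slope.
rewrite -(integral_const (L * alpha t ^+ 2 / 2)).
rewrite -ge0_integralD//; last 2 first.
- by move=> w _; rewrite lee_fin gap_ge0.
- exact: measurable_gap.
apply: ae_ge0_le_integral => //.
- by move=> w _; rewrite -EFinM -EFinD lee_fin addr_ge0 ?gap_ge0// mulr_ge0.
- apply: emeasurable_funD; first exact: measurable_gap.
  by apply: measurable_funeM; exact: measurable_slope.
- by move=> w _; rewrite -EFinD lee_fin addr_ge0 ?gap_ge0.
- by apply: emeasurable_funD => //; exact: measurable_gap.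
have mball : measurable [set v : 'rV[R]_d | norm2 v <= 1].
  rewrite (_ : mkset _ = @norm2 R d @^-1` `]-oo, 1]).
    by rewrite -[X in measurable X]setTI; apply: measurable_norm2.
  by apply/seteqP; split => v /=; rewrite in_itv.
have mS : measurable (s t @^-1` [set v : 'rV[R]_d | norm2 v <= 1]).
  exact: measurable_funPTI.
have PS : P (~` (s t @^-1` [set v : 'rV[R]_d | norm2 v <= 1])) = 0%E.
  rewrite probability_setC// [X in (1 - X)%E](_ : _ = 1%E) ?subee//.
  by rewrite -(search_unit distP); exact: (stp_law stpP t0).
exists (~` (s t @^-1` [set v : 'rV[R]_d | norm2 v <= 1])); split.
- exact: measurableC.
- exact: PS.
- apply: subsetC => w /= sw _; rewrite -EFinM -!EFinD lee_fin /gap.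
  have := stp_step_decrease t0 sw; lra.
Qed.

Lemma stp_rate (b a : R) (alpha0 : R) : alpha = (fun t => alpha0 / t%:R) ->
  alpha0 * mu / r = b -> 1 < b ->
  3 * b * (f theta1 - f theta_star) <= a ->
  L * alpha0 ^+ 2 / 2 <= a * (b - 1) ->
  forall T, (0 < T)%N ->
  ('E_P[f \o theta T] - (f theta_star)%:E <= (a / T%:R)%:E)%E.
Proof.
move=> alphaE bE b1 a1 a2 T T0.
pose e t := fine (\int[P]_w (gap t w)%:E)%E.
have int_ge0 t : (0 <= \int[P]_w (gap t w)%:E)%E.
  by apply: integral_ge0 => w _; rewrite lee_fin gap_ge0.
have int_le t : (0 < t)%N ->
    (\int[P]_w (gap t w)%:E <= (f theta1 - f theta_star)%:E)%E.
  move=> t0; rewrite -(integral_const (f theta1 - f theta_star)).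
  apply: ge0_le_integral => //.
    - by move=> w _; rewrite lee_fin gap_ge0.
    - exact: measurable_gap.
    - by move=> w _; rewrite lee_fin lerD2r stp_sublevel.
have intE t : (0 < t)%N -> (\int[P]_w (gap t w)%:E)%E = (e t)%:E.
  by move=> t0; rewrite fineK// ge0_fin_numE// (le_lt_trans (int_le t t0))// ltry.
(* [f] may change sign, but along the iterates it lies between [f theta_star] and [f theta1]; it is
   thus integrable and the constant moves under the integral. *)
have -> : ('E_P[f \o theta T] - (f theta_star)%:E = (e T)%:E)%E.
  rewrite -intE// unlock.
  rewrite -(integral_const (f theta_star)) -integralB//.
  - apply: measurable_bounded_integrable => //.
    + by rewrite ltey_eq fin_num_measure.
    + exact: measurable_f_theta.
    exists (`|f theta1| + `|f theta_star|); split; first exact: num_real.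
    move=> M ltM w _ /=; rewrite (le_trans _ (ltW ltM))//.
    have := objective_ge objP (theta T w); have := stp_sublevel w T0.
    rewrite ler_norml => le1 le2; apply/andP; split.
      have := ler_norm (- f theta_star); rewrite normrN.
      have := normr_ge0 (f theta1); lra.
    have := ler_norm (f theta1); have := normr_ge0 (f theta_star); lra.
  - exact: finite_measure_integrable_cst.
rewrite lee_fin.
apply: (harmonic_recursion (b := b) (c := L * alpha0 ^+ 2 / 2)
  (m := f theta1 - f theta_star)) => // t t0.
  by rewrite -!lee_fin -intE// int_ge0 int_le.
have := stp_expected_decrease t0; have := stp_expected_slope t0.
rewrite !intE// => slope.
have at0 := stp_alpha_gt0 stpP t0.
(* The slope bound times [alpha t] replaces the slope term of the expected decrease; since
   [alpha t * mu / r = b / t], this is the recursion. *)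
have /(lee_wpmul2l (ltW at0 : (0 <= (alpha t)%:E)%E)) := slope.
move=> /(leeD2l (e t.+1)%:E)/le_trans/[apply].
rewrite -!EFinM -!EFinD lee_fin alphaE -lerBrDr => /le_trans; apply.
have t_neq0 : t%:R != 0 :> R by rewrite pnatr_eq0 -lt0n.
have r_neq0 : r != 0 by rewrite gt_eqF.
rewrite le_eqVlt; apply/orP; left; apply/eqP; rewrite -bE; field.
by rewrite t_neq0.
Qed.
End stp_rate.

Theorem theorem4 (R : realType) :
  (forall (d : nat) (f : 'rV[R]_d -> R) (L : R) (theta_star : 'rV[R]_d)
      (D : probability 'rV[R]_d R) (N : 'rV[R]_d -> R) (mu : R)
      (theta1 : 'rV[R]_d),
    objective f L theta_star -> search_distribution D N mu ->
    ((0 < d)%N -> sublevel_radius f theta_star N theta1 \is a fin_num) /\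
    forall r : R, sublevel_radius f theta_star N theta1 = r%:E -> 0 < r ->
    forall alpha : R, r / mu < alpha ->
    forall (dO : measure_display) (Omega : measurableType dO)
      (P : probability Omega R) (s : nat -> {RV P >-> 'rV[R]_d})
      (theta : nat -> Omega -> 'rV[R]_d),
    stp f (fun t => alpha / t%:R) D theta1 s theta ->
    let a := Num.max (3 * alpha * mu / r * (f theta1 - f theta_star))
                     (L * alpha ^+ 2 / (2 * (alpha * mu / r - 1))) in
    forall T : nat, (0 < T)%N ->
      ('E_P[f \o theta T] - (f theta_star)%:E <= (a / T%:R)%:E)%E) /\
  (exists C : R -> R -> R -> R -> R,
    forall (d : nat) (f : 'rV[R]_d -> R) (L : R) (theta_star : 'rV[R]_d)
      (D : probability 'rV[R]_d R) (N : 'rV[R]_d -> R) (mu : R)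
      (theta1 : 'rV[R]_d),
    objective f L theta_star -> search_distribution D N mu ->
    forall r : R, sublevel_radius f theta_star N theta1 = r%:E -> 0 < r ->
    forall K : R, 0 < K -> mu = K / Num.sqrt d%:R ->
    forall (dO : measure_display) (Omega : measurableType dO)
      (P : probability Omega R) (s : nat -> {RV P >-> 'rV[R]_d})
      (theta : nat -> Omega -> 'rV[R]_d),
    stp f (fun t => (2 * r / mu) / t%:R) D theta1 s theta ->
    forall T : nat, (0 < T)%N ->
      ('E_P[f \o theta T] - (f theta_star)%:E <=
       (C K L r (f theta1 - f theta_star) * (d%:R / T%:R))%:E)%E).
Proof.
split=> [d f L theta_star D N mu theta1 objP distP|].
  split=> [d_gt0|r rE r_gt0 alpha ltalpha dO Omega P s theta stpP a T T0].
    apply: sublevel_radius_fin_num => //.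
    - exact: search_norm distP.
    - exact: objective_continuous objP.
    - exact: objective_convex objP.
    - exact: objective_bounded objP.
  have mu0 := search_mu_gt0 distP.
  have b1 : 1 < alpha * mu / r by rewrite ltr_pdivlMr// mul1r -ltr_pdivrMr.
  apply: (stp_rate objP distP rE r_gt0 stpP erefl erefl b1) => //.
    by rewrite le_max -!mulrA lexx.
  by rewrite -ler_pdivrMr ?subr_gt0// -[leLHS]mulrA -[X in _ * X]invfM le_max lexx orbT.
(* For [alpha = 2 r / mu] one has [b = 2], so the two requirements on [a] are [6 m <= a] and
   [2 L r^2 / mu^2 <= a], where [1 / mu^2 = d / K^2]. Taking [a = C d] meets both, the first because
   [d >= 1]. *)
exists (fun K L r m => Num.max (6 * m) (2 * L * r ^+ 2 / K ^+ 2)).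
move=> d f L theta_star D N mu theta1 objP distP r rE r_gt0 K K0 muE.
move=> dO Omega P s theta stpP T T0.
have mu0 := search_mu_gt0 distP.
have d1 : 1 <= d%:R :> R by rewrite ler1n (sublevel_radius_real_dim_gt0 rE).
have d0 : 0 < d%:R :> R by exact: lt_le_trans d1.
rewrite mulrA.
have b2 : 2 * r / mu * mu / r = 2 by field; rewrite !gt_eqF.
have m0 : 0 <= f theta1 - f theta_star by rewrite subr_ge0 (objective_ge objP).
apply: (stp_rate objP distP rE r_gt0 stpP erefl b2) => //.
- by rewrite ltr1n.
- set C := Num.max _ _; have C6 : 6 * (f theta1 - f theta_star) <= C.
    by rewrite le_max lexx.
  have : 0 <= C by rewrite (le_trans _ C6)// mulr_ge0.
  nra.
- rewrite (_ : 2 - 1 = 1) ?mulr1; last by ring.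
  rewrite [leLHS](_ : _ = 2 * L * r ^+ 2 / K ^+ 2 * d%:R).
    by rewrite ler_wpM2r ?ler0n// le_max lexx orbT.
  rewrite -[in RHS](sqr_sqrtr (ltW d0)) muE; field.
  by rewrite !gt_eqF// sqrtr_gt0.
Qed.
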